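(* Let $K$ be a field, $S=K[x_1,\ldots,x_n]$, and let $I\subset S$ be a monomial ideal with $\dim S/I=0$. Let $I^\wp\subset S^\wp$ be the polarization of $I$. The map $\phi$ which assigns to each monomial $u=x_1^{a_1}\cdots x_n^{a_n}\in S\setminus I$ the monomial prime ideal $\phi(u)=(x_{1,a_1+1},\ldots,x_{n,a_n+1})\subset S^\wp$ establishes a bijection between $\operatorname{Mon}(S\setminus I)$ and $\operatorname{Min}(I^\wp)$.
   Context: $\operatorname{Mon}(S\setminus I)$ is the (finite) set of monomials of $S$ not belonging to $I$. For a monomial ideal $I$, $G(I)$ is its unique minimal set of monomial generators. For $i=1,\ldots,n$ let $b_i\ge 1$ be the smallest integer with $x_i^{b_i}\in I$ (it exists since $\dim S/I=0$). $S^\wp$ is the polynomial ring over $K$ in the variables $x_{i,j}$, $1\le i\le n$, $1\le j\le b_i$. The polarization of a monomial $v=x_1^{c_1}\cdots x_n^{c_n}$ with $c_i\le b_i$ is $v^\wp=\prod_{i=1}^n\prod_{j=1}^{c_i}x_{i,j}$, and the polarization of $I$ is the ideal $I^\wp\subset S^\wp$ generated by the monomials $v^\wp$ with $v\in G(I)$. $\operatorname{Min}(I^\wp)$ is the set of minimal prime ideals of $I^\wp$. *)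

(* Defs.v *)
From HB Require Import structures.
From mathcomp Require Import all_boot all_order all_algebra.
From mathcomp Require Import boolp classical_sets functions.
From mathcomp Require Import mpoly.

Set Implicit Arguments.
Unset Strict Implicit.
Unset Printing Implicit Defensive.

Import GRing.Theory.
Local Open Scope ring_scope.
Local Open Scope classical_set_scope.

Section Ideals.
Variable R : comNzRingType.
Implicit Types J P Q : set R.

(* Unlike [idealr_closed], this allows the unit ideal. *)
Definition is_ideal J : Prop :=
  J 0 /\ forall a u v, J u -> J v -> J (a * u + v).

Definition ideal_gen (G : set R) : set R := smallest is_ideal G.

Definition prime_ideal P : Prop :=
  idealr_closed (mem P) /\ prime_idealr_closed (mem P).

Definition minimal_primes J : set (set R) :=
  [set P | [/\ prime_ideal P, J `<=` P &
    forall Q, prime_ideal Q -> J `<=` Q -> Q `<=` P -> Q = P]].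

(* Some strictly increasing chain P 0, ..., P d of prime ideals exists. *)
Definition has_prime_chain (d : nat) : Prop :=
  exists P : nat -> set R,
    (forall i, (i <= d)%N -> prime_ideal (P i)) /\
    (forall i, (i < d)%N -> P i `<` P i.+1).

End Ideals.

Definition has_krull_dim (R : comNzRingType) (d : nat) : Prop :=
  has_prime_chain R d /\ forall e, has_prime_chain R e -> (e <= d)%N.

(* Monomials of K[x_1, ..., x_n] are represented by their exponent vectors;
   indices of variables start at 0. *)
Section MonomialIdeals.
Variables (K : fieldType) (n : nat).
Implicit Types (I : set {mpoly K[n]}) (G : set 'X_{1..n}).

Definition monomial_gen G : set {mpoly K[n]} :=
  ideal_gen [set 'X_[m] | m in G].

Definition monomial_ideal I : Prop := exists G, I = monomial_gen G.

Definition mon_compl I : set 'X_{1..n} := [set u | ~ I 'X_[u]].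

Definition is_min_gens I G : Prop :=
  monomial_gen G = I /\
  forall G', G' `<=` G -> monomial_gen G' = I -> G' = G.

(* G(I) *)
Definition min_gens I : set 'X_{1..n} := xget set0 [set G | is_min_gens I G].

(* b_i; the default 0 is used when no power of x_i lies in I. *)
Definition bound I (i : 'I_n) : nat :=
  xget 0%N [set b | I ('X_i ^+ b) /\
                    forall c, I ('X_i ^+ c) -> (b <= c)%N].

End MonomialIdeals.

Section Polarization.
Variables (K : fieldType) (n : nat).

Definition pvar (b : 'I_n -> nat) : finType := {i : 'I_n & 'I_(b i)}.

Definition pring (b : 'I_n -> nat) := {mpoly K[#|pvar b|]}.

(* With j counted from 0, this is the variable x_{i,j+1} of the text. *)
Definition px (b : 'I_n -> nat) (i : 'I_n) (j : 'I_(b i)) : pring b :=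
  'X_(enum_rank (Tagged (fun i => 'I_(b i)) j : pvar b)).

(* Only meaningful when v i <= b i for all i. *)
Definition pmon (b : 'I_n -> nat) (v : 'X_{1..n}) : pring b :=
  \prod_(i < n) \prod_(j < b i | (j < v i)%N) px j.

Definition polarization (I : set {mpoly K[n]}) : set (pring (bound I)) :=
  ideal_gen [set pmon (bound I) v | v in min_gens I].

(* If u is not in I, then u i < b_i for all i, so there is exactly one
   generator, x_{i,u_i+1}, for each i. *)
Definition phi (I : set {mpoly K[n]}) (u : 'X_{1..n}) :
    set (pring (bound I)) :=
  ideal_gen [set p | exists (i : 'I_n) (j : 'I_(bound I i)),
    j = u i :> nat /\ p = px j].

End Polarization.

Arguments polarization {K n} I.
Arguments phi {K n} I u.

(* Main.v *)
(* An ideal generated by variables is the kernel of the endomorphism killing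
   these variables, hence prime; so if no power of x_i were in I, the ideals
   (x_j : j <> i) and (x_1, ..., x_n) would give a chain of length 1 in S/I.
   If u is not in I, then no generator v divides u, so v^p contains some
   x_{i,u_i+1} and phi(u) contains I^p. Conversely, a prime P containing I^p
   contains some x_{i,j} for each i, since it contains the polarization of a
   generator dividing x_i^{b_i}. With a_i + 1 the least such j, no generator
   divides u = x^a, so u is not in I and phi(u) is contained in P. As the ideals
   phi(u) are pairwise incomparable, they are exactly the minimal primes. *)

Require Import Defs.
From mathcomp Require Import all_boot all_order all_algebra.
From mathcomp Require Import boolp classical_sets functions.
From mathcomp Require Import generic_quotient ring_quotient mpoly.

Set Implicit Arguments.
Unset Strict Implicit.
Unset Printing Implicit Defensive.

Local Open Scope classical_set_scope.

(** * Ideals and prime ideals in a commutative ring *)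

Section IdealTheory.
Local Open Scope ring_scope.
Import GRing.Theory.
Variable R : comNzRingType.
Implicit Types J G P : set R.

Lemma is_idealM J a u : is_ideal J -> J u -> J (a * u).
Proof. by move=> [J0 JD] Ju; rewrite -[_ * _]addr0; apply: JD. Qed.

Lemma is_idealD J u v : is_ideal J -> J u -> J v -> J (u + v).
Proof. by move=> [J0 JD] Ju Jv; rewrite -[u]mul1r; apply: JD. Qed.

Lemma is_ideal_gen G : is_ideal (ideal_gen G).
Proof.
split=> [J [[J0 _] _] // | a u v Gu Gv J JG].
by case: (JG) => -[_ JD] _; apply: JD; [apply: Gu | apply: Gv].
Qed.

(** Trades the boolean closure predicates on [mem P] for propositions about the set [P]. *)
Lemma prime_idealP P : prime_ideal P <->
  [/\ is_ideal P, ~ P 1 & forall u v, P (u * v) -> P u \/ P v].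
Proof.
split=> [[[P0 P1 PD] PM] | [[P0 PD] P1 PM]].
  split; first split; first by move/set_mem: P0.
  - by move=> a u v /mem_set Pu /mem_set Pv; apply: set_mem (PD a u v Pu Pv).
  - by move=> P1'; move/negP: P1; apply; apply: mem_set.
  - move=> u v /mem_set /PM /orP[] /set_mem; first by left.
    by right.
split; first split.
- exact: mem_set.
- by apply/negP => /set_mem.
- move=> a u v /set_mem Pu /set_mem Pv; apply: mem_set; exact: PD.
- move=> u v /set_mem /PM [] ?; apply/orP; [left|right]; exact: mem_set.
Qed.

Lemma prime_ideal_prod P (T : eqType) (r : seq T) (Q : pred T) (F : T -> R) :
  prime_ideal P -> P (\prod_(x <- r | Q x) F x) ->
  exists2 x, Q x & P (F x).
Proof.
move=> /prime_idealP[_ P1 PM]; elim: r => [|x r IH]; first by rewrite big_nil.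
rewrite big_cons; case: ifP => [Qx /PM[Px|]|_]; [|exact: IH..].
by exists x.
Qed.

Lemma is_ideal_ker (S : comNzRingType) (f : {rmorphism R -> S}) :
  is_ideal [set x | f x = 0].
Proof.
split=> [|a u v /= fu fv]; first by rewrite /= rmorph0.
by rewrite rmorphD rmorphM fu fv mulr0 addr0.
Qed.

Lemma prime_ideal_ker (D : idomainType) (f : {rmorphism R -> D}) :
  prime_ideal [set x | f x = 0].
Proof.
apply/prime_idealP; split=> [||u v /=]; first exact: is_ideal_ker.
- by rewrite /= rmorph1 => /eqP; rewrite oner_eq0.
- by rewrite rmorphM => /eqP; rewrite mulf_eq0 => /orP[] /eqP; [left|right].
Qed.

End IdealTheory.

(** * Primes of a quotient ring *)

Section QuotientIdeals.
Local Open Scope ring_scope.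
Local Open Scope quotient_scope.
Import GRing.Theory.
Variables (R : comNzRingType) (I : idealr R).
Implicit Types J P : set R.

(** The chosen representative of the class of [x] differs from [x] by an element of [I], which [J]
    absorbs. *)
Lemma ideal_repr_pi J x :
  is_ideal J -> [set` I] `<=` J -> J (repr (\pi_({ideal_quot I}) x)) <-> J x.
Proof.
move=> Jid IJ; have Jd : J (repr (\pi_({ideal_quot I}) x) - x).
  by apply: IJ; rewrite /= Quotient.idealrBE reprK.
split=> Jx; last by rewrite -[repr _](subrK x); apply: is_idealD.
rewrite (_ : x = -1 * (repr (\pi_({ideal_quot I}) x) - x)
                + repr (\pi_({ideal_quot I}) x)).
  by case: Jid => _; apply.
by rewrite mulN1r opprB subrK.
Qed.

(** As [P] contains [I], testing one representative is testing all, so this set is the image of [P]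
    in the quotient. *)
Lemma prime_ideal_quot P :
  prime_ideal P -> [set` I] `<=` P ->
  @prime_ideal {ideal_quot I} [set x | P (repr x)].
Proof.
move=> /prime_idealP[Pid P1 PM] IP.
have reprP x := ideal_repr_pi x Pid IP.
apply/prime_idealP; split=> [||u v]; rewrite /=.
- split=> [|a u v]; rewrite /= -?[0](rmorph0 (\pi_({ideal_quot I}))).
    by apply/reprP; case: Pid.
  move=> Pu Pv; rewrite -[a]reprK -[u]reprK -[v]reprK -rmorphM -rmorphD.
  by apply/reprP; case: Pid => _; apply.
- by rewrite -(rmorph1 (\pi_({ideal_quot I}))) => /reprP.
- by rewrite -{1}[u]reprK -{1}[v]reprK -rmorphM => /reprP/PM.
Qed.

End QuotientIdeals.

(** * Ideals generated by variables, and monomial ideals *)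

Section MonomialTheory.
Local Open Scope ring_scope.
Import GRing.Theory.

(** The target keeps all the variables, so that [p - vkill A p] makes sense. *)
Definition vkill (R : comNzRingType) (n : nat) (A : {pred 'I_n}) :
    {rmorphism {mpoly R[n]} -> {mpoly R[n]}} :=
  mmap (@mpolyC n R) (fun i => if i \in A then 0 else 'X_i).
Arguments vkill {R n} A.

Lemma vkillU (R : comNzRingType) n (A : {pred 'I_n}) i :
  vkill A 'X_i = if i \in A then 0 else 'X_i :> {mpoly R[n]}.
Proof. by rewrite /vkill /= mmapX mmap1U. Qed.

Lemma ideal_gen_vars (R : comNzRingType) n (A : {pred 'I_n}) :
  ideal_gen [set ('X_i : {mpoly R[n]}) | i in [set` A]] =
  [set p | vkill A p = 0].
Proof.
set J := ideal_gen _; have Jid : is_ideal J by apply: is_ideal_gen.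
apply/seteqP; split.
  apply: smallest_sub => [|_ [i Ai <-]]; first exact: is_ideal_ker.
  by have := vkillU R A i; rewrite (Ai : i \in A).
have JX i : i \in A -> J 'X_i by move=> Ai; apply: sub_gen_smallest; exists i.
(* Setting the variables in A to zero does not change p modulo J. *)
suff H p : J (p - vkill A p) by move=> p p0; rewrite -[p]subr0 -p0.
(* From here on [J] is any ideal containing the variables in [A]. The claim passes to products and
   sums, so constants and variables suffice. *)
move: J Jid JX => J Jid JX.
have HM u v : J (u - vkill A u) -> J (v - vkill A v) ->
    J (u * v - vkill A (u * v)).
  move=> Ju Jv; rewrite rmorphM.
  have -> : u * v - vkill A u * vkill A v =
    u * (v - vkill A v) + vkill A v * (u - vkill A u).
    by rewrite !mulrBr addrA [_ * u]mulrC subrK [_ * vkill A u]mulrC.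
  by apply: is_idealD => //; apply: is_idealM.
have H0 : J (0 - vkill A 0) by rewrite rmorph0 subr0; case: Jid.
have H1 : J (1 - vkill A 1) by rewrite rmorph1 subrr; case: Jid.
have HX m : J ('X_[m] - vkill A 'X_[m]).
  rewrite mpolyXE_id; elim/big_ind: _ => // i _.
  elim: (m i) => [|k IH]; first by rewrite expr0.
  rewrite exprS; apply: HM => //; rewrite vkillU; case: ifP => iA.
    by rewrite subr0; apply: JX.
  by rewrite subrr; case: Jid.
elim/mpolyind: p => // c m p _ _ IH.
rewrite rmorphD opprD addrACA; apply: is_idealD => //.
rewrite -mul_mpolyC; apply: HM => //.
by rewrite /vkill /= mmapC subrr; case: Jid.
Qed.

Lemma prime_vars (K : idomainType) n (A : {pred 'I_n}) :
  prime_ideal (ideal_gen [set ('X_i : {mpoly K[n]}) | i in [set` A]]).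
Proof. by rewrite ideal_gen_vars; apply: prime_ideal_ker. Qed.

Lemma mem_vars (R : comNzRingType) n (A : {pred 'I_n}) i :
  ideal_gen [set ('X_i : {mpoly R[n]}) | i in [set` A]] 'X_i <-> i \in A.
Proof.
rewrite ideal_gen_vars /= vkillU; case: ifP => // _; split=> // /eqP.
by rewrite -msupp_eq0 msuppX.
Qed.

Variables (K : fieldType) (n : nat).
Implicit Types G : set 'X_{1..n}.

Lemma monomial_genX G m :
  monomial_gen (K := K) G 'X_[m] <-> exists2 g, G g & (g <= m)%MM.
Proof.
split=> [|[g Gg le_gm]]; last first.
  rewrite -(submK le_gm) mpolyXD; apply: (is_idealM _ (is_ideal_gen _)).
  by apply: sub_gen_smallest; exists g.
(* The polynomials all of whose monomials are divisible by a generator form an ideal containing the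
   generators. *)
pose J : set {mpoly K[n]} :=
  [set p | forall k, k \in msupp p -> exists2 g, G g & (g <= k)%MM].
suff : monomial_gen (K := K) G `<=` J by move=> /[apply]; apply; rewrite msuppX inE.
apply: smallest_sub => [|_ [g Gg <-] k]; last first.
  by rewrite msuppX inE => /eqP ->; exists g => //; apply: lepm_refl.
split=> [k|a u v Ju Jv k]; first by rewrite msupp0.
move=> /msuppD_le; rewrite mem_cat => /orP[/msuppM_le|/Jv //].
move=> /allpairsP[[m1 m2] /= [_ /Ju[g Gg le_g] ->]]; exists g => //.
by apply: lepm_trans le_g _; apply: lem_addl.
Qed.

Lemma min_gens_gen (I : set {mpoly K[n]}) :
  monomial_ideal I -> monomial_gen (K := K) (min_gens I) = I.
Proof.
move=> [G IG]; suff : is_min_gens I (min_gens I) by case.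
rewrite /min_gens; apply: xgetPex.
(* The witness is the set of monomials of [I] that are minimal under divisibility; by induction on
   the degree, each monomial of [I] is a multiple of one of them. *)
pose M : set 'X_{1..n} :=
  [set g | I 'X_[g] /\ forall h, I 'X_[h] -> (h <= g)%MM -> h = g].
have below m : I 'X_[m] -> exists2 g, M g & (g <= m)%MM.
  have [d] := ubnP (mdeg m); elim: d m => // d IH m ltmd Im.
  have [Mm|nMm] := pselect (M m); first by exists m => //; apply: lepm_refl.
  have [h Ih [le_hm neq_hm]] : exists2 h, I 'X_[h] & (h <= m)%MM /\ h <> m.
    apply: contrapT => nh; apply: nMm; split=> // h Ih le_hm.
    by apply: contrapT => neq; apply: nh; exists h.
  have lt_hm : (mdeg h < mdeg m)%N.
    have /(congr1 mdeg) := submK le_hm; rewrite mdegD => <-.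
    rewrite -[X in (X < _)%N]add0n ltn_add2r lt0n mdeg_eq0; apply/eqP => mh0.
    by apply: neq_hm; rewrite -(submK le_hm) mh0 add0m.
  have [g Mg le_gh] := IH h (leq_trans lt_hm ltmd) Ih.
  by exists g => //; apply: lepm_trans le_gh le_hm.
exists M; split.
  apply/seteqP; split.
    apply: smallest_sub => [|_ [g [Ig _] <-] //].
    by rewrite IG; apply: is_ideal_gen.
  rewrite {1}IG; apply: smallest_sub => [|_ [g Gg <-]]; first exact: is_ideal_gen.
  by apply/monomial_genX/below; rewrite IG; apply: sub_gen_smallest; exists g.
move=> G' G'M G'I; apply/seteqP; split=> // g [Ig gmin].
(* Some [h] in [G'] divides [g], and minimality of [g] forces [h = g]. *)
have /monomial_genX[h G'h le_hg] : monomial_gen (K := K) G' 'X_[g] by rewrite G'I.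
by rewrite -(gmin h) //; case: (G'M h G'h).
Qed.

(** Guarantees that each [bound] is a true minimum and not the default 0. *)
Lemma dim0_powers (I : idealr {mpoly K[n]}) :
  monomial_ideal [set` I] -> has_krull_dim {ideal_quot I} 0 ->
  forall i, exists c, [set` I] ('X_i ^+ c).
Proof.
move=> [G IG] [_ dimI] i; apply: contrapT => noc.
have I1 : ~ [set` I] 1 by rewrite /= idealr1.
have subV (A : {pred 'I_n}) : (forall g, G g -> exists2 j, j \in A & g j != 0%N) ->
    [set` I] `<=` ideal_gen [set 'X_i | i in [set` A]].
  move=> GA; rewrite IG; apply: smallest_sub; first exact: is_ideal_gen.
  move=> _ [g /GA[j Aj gj] <-].
  have le_jg : (U_(j) <= g)%MM.
    apply/mnm_lepP => k; rewrite mnm1E; case: eqP => // <-.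
    by rewrite lt0n.
  rewrite -(submK le_jg) mpolyXD; apply: (is_idealM _ (is_ideal_gen _)).
  by apply/mem_vars.
have GI g : G g -> [set` I] 'X_[g].
  by move=> Gg; rewrite IG; apply: sub_gen_smallest; exists g.
(* A generator involving no variable other than x_i would be a power of x_i in [I]. *)
have GA0 g : G g -> exists2 j, j \in [pred j | j != i] & g j != 0%N.
  move=> Gg; apply: contrapT => nj; apply: noc; exists (g i).
  suff -> : 'X_i ^+ g i = 'X_[g] :> {mpoly K[n]} by apply: GI.
  rewrite [RHS]mpolyXE_id (bigD1 i) //= big1 ?mulr1 // => j ji.
  have [->|gj] := eqVneq (g j) 0%N; first by rewrite expr0.
  by case: nj; exists j.
have GA1 g : G g -> exists2 j, j \in predT & g j != 0%N.
  by move=> /GA0[j _ gj]; exists j.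
pose P (A : {pred 'I_n}) : set {mpoly K[n]} :=
  ideal_gen [set 'X_i | i in [set` A]].
suff /dimI : has_prime_chain {ideal_quot I} 1 by [].
exists (fun k => [set x | P (if k is 0 then [pred j | j != i] else predT) (repr x)]).
split=> [[|k] _|[|//] _].
- by apply: prime_ideal_quot; [apply: prime_vars | apply: subV].
- by apply: prime_ideal_quot; [apply: prime_vars | apply: subV].
split=> [x /=|H].
  by apply: sub_smallest2r; [apply: is_ideal_gen | move=> _ [j _ <-]; exists j].
have PT := ideal_repr_pi 'X_i (is_ideal_gen _) (subV _ GA1).
have P0 := ideal_repr_pi 'X_i (is_ideal_gen _) (subV _ GA0).
(* The inclusion is strict: x_i lies in the larger ideal only. *)
have /PT/H/P0/mem_vars : P predT 'X_i by apply/mem_vars.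
by rewrite inE eqxx.
Qed.


Lemma mon_complP (I : set {mpoly K[n]}) (u v : 'X_{1..n}) :
  monomial_ideal I -> mon_compl I u -> (v <= u)%MM -> mon_compl I v.
Proof.
move=> [G ->] Iu le_vu Iv; apply: Iu; rewrite -(submK le_vu) mpolyXD.
exact: is_idealM (is_ideal_gen _) Iv.
Qed.

Lemma boundP (I : set {mpoly K[n]}) (i : 'I_n) :
  (exists c, I ('X_i ^+ c)) -> I ('X_i ^+ bound I i).
Proof.
move=> [c Ic]; suff : [set b | I ('X_i ^+ b) /\
    forall d, I ('X_i ^+ d) -> (b <= d)%N] (bound I i) by case.
apply: xgetPex.
have ex : exists c, `[< I ('X_i ^+ c) >] by exists c; apply/asboolP.
case: (ex_minnP ex) => b /asboolP Ib bmin; exists b; split=> // d Id.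
by apply: bmin; apply/asboolP.
Qed.

(** Otherwise x_i^{b_i} would divide [u]. Hence [u i] is a valid index into the variables x_{i,j},
    counted from 0. *)
Lemma bound_gt (I : set {mpoly K[n]}) (u : 'X_{1..n}) (i : 'I_n) :
  monomial_ideal I -> (exists c, I ('X_i ^+ c)) -> mon_compl I u ->
  (u i < bound I i)%N.
Proof.
move=> monI /boundP Ib Iu; rewrite ltnNge; apply/negP => le_bu.
have le_bu' : (U_(i) *+ bound I i <= u)%MM.
  apply/mnm_lepP => j; rewrite mulmnE mnm1E.
  by case: eqP => [<-|_]; rewrite ?mul1n ?mul0n.
by case: (mon_complP monI Iu le_bu'); rewrite -mpolyXn.
Qed.

End MonomialTheory.

(** * The minimal primes of the polarization *)

Section PolarizationTheory.
Local Open Scope ring_scope.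
Import GRing.Theory.
Variables (K : fieldType) (n : nat) (I : set {mpoly K[n]}).
Hypothesis monI : monomial_ideal I.
Hypothesis powI : forall i : 'I_n, exists c, I ('X_i ^+ c).
Implicit Types (u v : 'X_{1..n}) (P : set (pring K (bound I))).

Let var (k : 'I_#|pvar (bound I)|) : {i : 'I_n & 'I_(bound I i)} :=
  @enum_val (pvar (bound I)) predT k.

(** The ranks of the variables generating [phi I u], which makes the results on ideals of variables
    applicable. *)
Let phi_set u : {pred 'I_#|pvar (bound I)|} :=
  [pred k | (tagged (var k) : nat) == u (tag (var k))].

Let phiE u : phi I u = ideal_gen [set 'X_k | k in [set` phi_set u]].
Proof.
congr ideal_gen; apply/seteqP; split=> [_ [i [j [ju ->]]]|_ [k /eqP ku <-]].
  exists (enum_rank (Tagged (fun i => 'I_(bound I i)) j : pvar (bound I))) => //.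
  by rewrite /= inE /= /var enum_rankK /= ju.
exists (tag (var k)), (tagged (var k)); split=> //.
by rewrite /px (_ : Tagged _ _ = var k) ?enum_valK //; case: (var k).
Qed.

Lemma phi_prime u : prime_ideal (phi I u).
Proof. by rewrite phiE; apply: prime_vars. Qed.

Lemma phi_px u i (j : 'I_(bound I i)) : phi I u (px K j) <-> j = u i :> nat.
Proof.
rewrite phiE /px; split=> [/mem_vars|ju].
  by rewrite inE /= /var enum_rankK /= => /eqP.
by apply/mem_vars; rewrite inE /= /var enum_rankK /= ju.
Qed.

Lemma phi_sub u P : is_ideal P ->
  (forall i (j : 'I_(bound I i)), j = u i :> nat -> P (px K j)) ->
  phi I u `<=` P.
Proof.
by move=> Pid Pu; apply: smallest_sub => // _ [i [j [ju ->]]]; apply: Pu.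
Qed.

Lemma polarization_sub_phi u : mon_compl I u -> polarization I `<=` phi I u.
Proof.
move=> Iu; apply: smallest_sub => [|_ [v Gv <-]]; first exact: is_ideal_gen.
have Iv : I 'X_[v].
  rewrite -(min_gens_gen monI); apply/monomial_genX; exists v => //.
  exact: lepm_refl.
have [i lt_uv] : exists i, (u i < v i)%N.
  apply: contrapT => nlt; apply: (mon_complP monI Iu) Iv.
  by apply/mnm_lepP => i; rewrite leqNgt; apply/negP => lt; apply: nlt; exists i.
(* Counted from 0, this index names x_{i,u_i+1}, a factor of the polarization of [v] because u_i <
   v_i. *)
pose j := Ordinal (bound_gt monI (powI i) Iu).
rewrite /pmon (bigD1 i) //= (bigD1 j) //= -mulrA mulrC.
by apply: (is_idealM _ (is_ideal_gen _)); apply/phi_px.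
Qed.

Lemma prime_contains_phi P : prime_ideal P -> polarization I `<=` P ->
  exists2 u, mon_compl I u & phi I u `<=` P.
Proof.
move=> Ppr IP.
have pxP v : min_gens I v -> exists i (j : 'I_(bound I i)), (j < v i)%N /\ P (px K j).
  move=> Gv; have : P (pmon K (bound I) v).
    by apply: IP; apply: sub_gen_smallest; exists v.
  by move=> /(prime_ideal_prod Ppr)[i _ /(prime_ideal_prod Ppr)[j]]; exists i, j.
have ex i : exists j, [exists k : 'I_(bound I i), (k == j :> nat) && `[< P (px K k) >]].
  have /monomial_genX[v Gv /mnm_lepP le_v] :
    monomial_gen (K := K) (min_gens I) 'X_[U_(i) *+ bound I i].
    by rewrite (min_gens_gen monI) -mpolyXn; apply: boundP.
  (* As [v] divides x_i^{b_i}, it involves no variable but x_i, so [k = i]. *)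
  have [k [j [lt_j Pj]]] := pxP v Gv.
  have := le_v k; rewrite mulmnE mnm1E; case: eqP => [ik _|_]; last first.
    by rewrite mul0n leqn0 => /eqP v0; rewrite v0 in lt_j.
  subst k; exists j; apply/existsP; exists j; rewrite eqxx /=; exact/asboolP.
pose u := [multinom ex_minn (ex i) | i < n].
have uP i (j : 'I_(bound I i)) : P (px K j) -> (u i <= j)%N.
  move=> Pj; rewrite mnmE; case: ex_minnP => m _; apply.
  by apply/existsP; exists j; rewrite eqxx /=; apply/asboolP.
exists u.
  (* A generator [v] dividing [u] would give some x_{i,j} in [P] with j < v_i <= u_i <= j. *)
  move=> Iu; have /monomial_genX[v Gv /mnm_lepP le_vu] :
    monomial_gen (K := K) (min_gens I) 'X_[u] by rewrite (min_gens_gen monI).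
  have [i [j [lt_jv /uP le_uj]]] := pxP v Gv.
  by have := leq_trans lt_jv (leq_trans (le_vu i) le_uj); rewrite ltnn.
apply: phi_sub => [|i j]; first by case/prime_idealP: Ppr.
rewrite mnmE; case: ex_minnP => m /existsP[k /andP[/eqP <- /asboolP Pk]] _ jk.
by rewrite (val_inj jk).
Qed.

(** The variable x_{i,u_i+1} lies in [phi I v] only if u_i = v_i. Assuming just an inclusion serves
    both injectivity and minimality. *)
Lemma phi_inj u v : mon_compl I u -> phi I u `<=` phi I v -> u = v.
Proof.
move=> Iu uv; apply/mnmP => i; pose j := Ordinal (bound_gt monI (powI i) Iu).
by have /uv/phi_px : phi I u (px K j) by apply/phi_px.
Qed.

Lemma phi_bij : set_bij (mon_compl I) (minimal_primes (polarization I)) (phi I).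
Proof.
split=> [u Iu|u v /set_mem Iu _ uv|P [Ppr IP Pmin]].
- split=> [||Q Qpr IQ Qu]; [exact: phi_prime|exact: polarization_sub_phi|].
  (* Now [phi I v] lies in [Q], hence in [phi I u], so [v = u] and [Q] is squeezed between equal
     ideals. *)
  have [v Iv vQ] := prime_contains_phi Qpr IQ.
  apply/seteqP; split=> //.
  by rewrite -(phi_inj Iv (subset_trans vQ Qu)).
- by apply: phi_inj => //; rewrite uv.
have [u Iu uP] := prime_contains_phi Ppr IP; exists u => //.
by apply: Pmin => //; [exact: phi_prime|exact: polarization_sub_phi].
Qed.

End PolarizationTheory.

Theorem theorem1p1 (K : fieldType) (n : nat) (I : idealr {mpoly K[n]})
    (monI : monomial_ideal [set` I])
    (dimI : has_krull_dim {ideal_quot I} 0) :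
  set_bij (mon_compl [set` I])
          (minimal_primes (polarization [set` I]))
          (phi [set` I]).
Proof. exact: phi_bij monI (dim0_powers monI dimI). Qed.
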